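(* For every $\mathcal{L}$-sentence $\varphi$: $T_{\mathrm{MSO(Fin)}} \models \varphi$ if and only if $\mathrm{MSO}(n) \models \varphi$ for every $n \in \mathbb{N}$. That is, $T_{\mathrm{MSO(Fin)}}$ axiomatises the pseudofinite monadic second order theory of linear order $\bigcap_{n\in\mathbb{N}} \mathrm{Th}(\mathrm{MSO}(n))$.
   Context: $\mathbb{N}=\{0,1,2,\dots\}$. Let $\mathcal{L}=\{\subseteq,\bot,\mathrm{At},\lhd\}$ be the first-order language with binary relation symbols $\subseteq,\lhd$, a constant symbol $\bot$ and a unary relation symbol $\mathrm{At}$. For a linear order $(\alpha,<)$, $\mathrm{MSO}(\alpha)$ is the $\mathcal{L}$-structure with universe the power set $\mathcal{P}(\alpha)$, $\subseteq$ interpreted as inclusion, $\bot$ as $\emptyset$, $\mathrm{At}$ as the set of singletons, and $A \lhd B$ iff there are $a\in A$, $b\in B$ with $a<b$. $\mathrm{MSO}(n)$ denotes $\mathrm{MSO}$ of the $n$-element linear order (so $\mathrm{MSO}(0)$ is the one-element structure). Lowercase variables range over atoms (elements satisfying $\mathrm{At}$) and $X(x)$ abbreviates $x\subseteq X$. $T_{\mathrm{base}}$ is the $\mathcal{L}$-theory stating: (1) $\subseteq$ is the order of an atomic Boolean algebra (the degenerate one-element algebra allowed); (2) $\lhd$ restricted to atoms is a linear order; (3) $\bot$ is the least element; (4) $\mathrm{At}$ holds exactly of the atoms; (5) $\forall X\forall Y(X\lhd Y\leftrightarrow\exists x\exists y(X(x)\wedge Y(y)\wedge x\lhd y))$; (6)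 for every $\mathcal{L}$-formula $\eta(x;\bar Y)$, the comprehension axiom $\forall\bar Y\exists X\forall x(X(x)\leftrightarrow\eta(x;\bar Y))$. $T_{\mathrm{MSO(Fin)}}$ is $T_{\mathrm{base}}$ together with axioms stating (i) the order $\lhd$ on atoms is discrete with endpoints, and (ii) every non-bottom element contains a $\lhd$-least atom: $\forall X(X\neq\bot\rightarrow\exists x(X(x)\wedge\forall y(y\lhd x\rightarrow\neg X(y))))$. *)

(* Defs.v *)
From mathcomp Require Import all_boot all_order.
From mathcomp Require Import boolp classical_sets.

Set Implicit Arguments.
Unset Strict Implicit.
Unset Printing Implicit Defensive.

Import Order.TTheory.
Local Open Scope classical_set_scope.

(** ** First-order logic with equality over {⊆, ⊥, At, ◁}, with named variables *)

Inductive term : Type :=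
  | Var of nat
  | Bot.

Inductive formula : Type :=
  | Eq of term & term
  | Incl of term & term
  | At of term
  | Lhd of term & term
  | Not of formula
  | And of formula & formula
  | Or of formula & formula
  | Imp of formula & formula
  | All of nat & formula
  | Ex of nat & formula.

Coercion Var : nat >-> term.

Definition Iff (p q : formula) : formula := And (Imp p q) (Imp q p).

(* Quantifiers over atoms: the lowercase variables of the axioms. *)
Definition AllAt (x : nat) (p : formula) : formula := All x (Imp (At x) p).
Definition ExAt (x : nat) (p : formula) : formula := Ex x (And (At x) p).

Declare Scope fo_scope.
Delimit Scope fo_scope with fo.
Bind Scope fo_scope with formula.

Notation "⊥" := Bot : fo_scope.
Notation "s == t" := (Eq s t) : fo_scope.
Notation "s != t" := (Not (Eq s t)) : fo_scope.
Notation "s ⊆ t" := (Incl s t) (at level 70, no associativity) : fo_scope.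
Notation "s ◁ t" := (Lhd s t) (at level 70, no associativity) : fo_scope.
Notation "~ p" := (Not p) : fo_scope.
Notation "p /\ q" := (And p q) : fo_scope.
Notation "p \/ q" := (Or p q) : fo_scope.
Notation "p -> q" := (Imp p q) : fo_scope.
Notation "p <-> q" := (Iff p q) : fo_scope.
Notation "∀ X , p" := (All X p) (at level 200, X at level 0) : fo_scope.
Notation "∃ X , p" := (Ex X p) (at level 200, X at level 0) : fo_scope.
Notation "∀' x , p" := (AllAt x p) (at level 200, x at level 0) : fo_scope.
Notation "∃' x , p" := (ExAt x p) (at level 200, x at level 0) : fo_scope.

Definition term_fv (t : term) : seq nat := if t is Var x then [:: x] else [::].

Fixpoint fv (p : formula) : seq nat :=
  match p with
  | Eq s t | Incl s t | Lhd s t => term_fv s ++ term_fv t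
  | At t => term_fv t
  | Not q => fv q
  | And q r | Or q r | Imp q r => fv q ++ fv r
  | All x q | Ex x q => [seq y <- fv q | y != x]
  end.

Definition sentence (p : formula) : Prop := fv p = [::].

Definition alls (ys : seq nat) (p : formula) : formula := foldr All p ys.

Record structure : Type := Structure {
  carrier :> Type;
  incl : carrier -> carrier -> Prop;
  bot : carrier;
  at_ : carrier -> Prop;
  lhd : carrier -> carrier -> Prop
}.

Definition eval (M : structure) (v : nat -> M) (t : term) : M :=
  if t is Var x then v x else bot M.

Fixpoint sat (M : structure) (v : nat -> M) (p : formula) : Prop :=
  match p with
  | Eq s t => eval v s = eval v t
  | Incl s t => incl (eval v s) (eval v t)
  | At t => at_ (eval v t)
  | Lhd s t => lhd (eval v s) (eval v t)
  | Not q => ~ sat v q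
  | And q r => sat v q /\ sat v r
  | Or q r => sat v q \/ sat v r
  | Imp q r => sat v q -> sat v r
  | All x q => forall a : M, sat [eta v with x |-> a] q
  | Ex x q => exists a : M, sat [eta v with x |-> a] q
  end.

(* Truth of a sentence; on a formula with free variables this is the truth of
   its universal closure. *)
Definition holds (M : structure) (p : formula) : Prop :=
  forall v : nat -> M, sat v p.

Definition theory : Type := formula -> Prop.

Definition model (M : structure) (T : theory) : Prop :=
  forall p, T p -> holds M p.

Definition entails (T : theory) (p : formula) : Prop :=
  forall M : structure, model M T -> holds M p.

(** ** The theories *)

Section Theories.

Local Notation X := 0%N.
Local Notation Y := 1%N.
Local Notation Z := 2%N.
Local Notation U := 3%N.
Local Notation V := 4%N.
Local Notation P := 5%N.
Local Notation Q := 6%N.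
Local Notation W := 7%N.
Local Notation x := 8%N.
Local Notation y := 9%N.
Local Notation z := 10%N.

(* [m] is the meet (join) of [s] and [t]; [W] is bound here, so the arguments
   must be different from [W]. *)
Definition is_meet (m s t : term) : formula :=
  m ⊆ s /\ m ⊆ t /\ (∀ W, W ⊆ s /\ W ⊆ t -> W ⊆ m).
Definition is_join (m s t : term) : formula :=
  s ⊆ m /\ t ⊆ m /\ (∀ W, s ⊆ W /\ t ⊆ W -> m ⊆ W).

Inductive T_base : theory :=
  (* ⊆ is the order of an atomic Boolean algebra, possibly with ⊥ = ⊤ *)
  | base_refl : T_base (∀ X, X ⊆ X)%fo
  | base_antisym : T_base (∀ X, ∀ Y, X ⊆ Y /\ Y ⊆ X -> X == Y)%fo
  | base_trans : T_base (∀ X, ∀ Y, ∀ Z, X ⊆ Y /\ Y ⊆ Z -> X ⊆ Z)%fo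
  | base_meet : T_base (∀ X, ∀ Y, ∃ Z, is_meet Z X Y)%fo
  | base_join : T_base (∀ X, ∀ Y, ∃ Z, is_join Z X Y)%fo
  | base_top : T_base (∃ X, ∀ Y, Y ⊆ X)%fo
    (* X ∧ (Y ∨ Z) = (X ∧ Y) ∨ (X ∧ Z) *)
  | base_distr : T_base (∀ X, ∀ Y, ∀ Z, ∀ U, ∀ V, ∀ P, ∀ Q,
      is_join U Y Z /\ is_meet V X U /\ is_meet P X Y /\ is_meet Q X Z ->
      is_join V P Q)%fo
  | base_compl : T_base (∀ X, ∃ Y,
      is_meet ⊥ X Y /\ (∃ Z, (∀ U, U ⊆ Z) /\ is_join Z X Y))%fo
  | base_atomic : T_base (∀ X, X != ⊥ -> ∃' x, x ⊆ X)%fo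
  (* ◁ is a strict linear order on atoms *)
  | base_irrefl : T_base (∀' x, ~ (x ◁ x))%fo
  | base_lhd_trans : T_base (∀' x, ∀' y, ∀' z, x ◁ y /\ y ◁ z -> x ◁ z)%fo
  | base_total : T_base (∀' x, ∀' y, x ◁ y \/ x == y \/ y ◁ x)%fo
  | base_bot : T_base (∀ X, ⊥ ⊆ X)%fo
  | base_at : T_base (∀ X,
      At X <-> (X != ⊥ /\ (∀ Y, Y ⊆ X -> Y == ⊥ \/ Y == X)))%fo
  | base_lhd : T_base (∀ X, ∀ Y,
      X ◁ Y <-> (∃' x, ∃' y, x ⊆ X /\ y ⊆ Y /\ x ◁ y))%fo
  (* comprehension; here the variables [a] (for x), [A] (for X) and [Ys] are
     arbitrary, and [A] is not free in [eta] *)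
  | base_comprehension (eta : formula) (a A : nat) (Ys : seq nat) :
      uniq [:: a, A & Ys] ->
      {subset fv eta <= a :: Ys} ->
      T_base (alls Ys (∃ A, ∀' a, a ⊆ A <-> eta))%fo.

Inductive T_MSOFin : theory :=
  | fin_base p : T_base p -> T_MSOFin p
  (* ◁ is discrete on atoms, with endpoints; the existence of endpoints is
     required only if there are atoms, so that MSO(0) is a model *)
  | fin_succ : T_MSOFin (∀' x,
      (∃' y, x ◁ y) -> ∃' y, x ◁ y /\ ~ (∃' z, x ◁ z /\ z ◁ y))%fo
  | fin_pred : T_MSOFin (∀' x,
      (∃' y, y ◁ x) -> ∃' y, y ◁ x /\ ~ (∃' z, y ◁ z /\ z ◁ x))%fo
  | fin_first : T_MSOFin ((∃ x, At x) -> ∃' x, ∀' y, x == y \/ x ◁ y)%fo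
  | fin_last : T_MSOFin ((∃ x, At x) -> ∃' x, ∀' y, x == y \/ y ◁ x)%fo
  (* every non-bottom element contains a least atom *)
  | fin_least : T_MSOFin (∀ X,
      X != ⊥ -> ∃' x, x ⊆ X /\ (∀' y, y ◁ x -> ~ (y ⊆ X)))%fo.

End Theories.

(** ** The standard structures *)

Definition MSO (d : Order.disp_t) (alpha : orderType d) : structure :=
  {| carrier := set alpha;
     incl := fun A B => A `<=` B;
     bot := set0;
     at_ := fun A => exists a, A = [set a];
     lhd := fun A B => exists a b, [/\ A a, B b & (a < b)%O] |}.

Definition MSOn (n : nat) : structure := MSO 'I_n.

(* Main.v *)
(* Each formula has a deterministic finite automaton over the letters recording
   which variables contain a given atom (quantifiers are the subset
   construction). In every model of the theory, reading the atoms in increasing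
   order makes sense semantically: the state reached at an atom is determined by
   the state at its predecessor, and a formula is satisfied iff the state reached
   after all atoms is accepting. That state is definable from the end point, so
   comprehension and the least atom axiom allow induction along the order: on the
   constant letter, the final state in any model is the state reached after some
   standard number [n] of steps, hence is the final state of MSO(n). *)

From mathcomp Require Import all_boot all_order.
From mathcomp Require Import boolp classical_sets.
Require Import Defs.

Set Implicit Arguments.
Unset Strict Implicit.
Unset Printing Implicit Defensive.

(** * Valuations and the coincidence lemma *)

(** Convertible with the update used in [sat], so that quantifier clauses unfold by conversion while
    updates keep a name to rewrite with. *)
Definition upd (T : Type) (v : nat -> T) (x : nat) (a : T) : nat -> T :=
  fun y => if y == x then a else v y.

Lemma updE (T : Type) (v : nat -> T) x a : upd v x a x = a.
Proof. by rewrite /upd eqxx. Qed.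

Lemma upd_neq (T : Type) (v : nat -> T) x a y : y != x -> upd v x a y = v y.
Proof. by rewrite /upd => /negbTE ->. Qed.

Lemma upd_id (T : Type) (v : nat -> T) x : upd v x (v x) = v.
Proof. by apply/funext => y; rewrite /upd; case: eqP => // ->. Qed.

Lemma eval_upd (M : structure) (v : nat -> M) x a t :
  x \notin term_fv t -> eval (upd v x a) t = eval v t.
Proof. by case: t => //= y; rewrite inE eq_sym; exact: upd_neq. Qed.

Lemma sat_All (M : structure) (v : nat -> M) x p :
  sat v (All x p) = (forall a, sat (upd v x a) p).
Proof. by []. Qed.

Lemma sat_Ex (M : structure) (v : nat -> M) x p :
  sat v (Ex x p) = (exists a, sat (upd v x a) p).
Proof. by []. Qed.

Lemma sat_AllAt (M : structure) (v : nat -> M) x p :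
  sat v (AllAt x p) <-> (forall a, at_ a -> sat (upd v x a) p).
Proof.
split=> H a; have := H a; rewrite /= -/(upd v x a) eqxx => Ha; exact: Ha.
Qed.

Lemma eval_coincidence (M : structure) (v w : nat -> M) t :
  {in term_fv t, v =1 w} -> eval v t = eval w t.
Proof. by case: t => //= x; apply; rewrite inE. Qed.

Lemma sat_coincidence (M : structure) (p : formula) (v w : nat -> M) :
  {in fv p, v =1 w} -> (sat v p <-> sat w p).
Proof.
have sub (s1 s2 : seq nat) (v1 w1 : nat -> M) : {in s1 ++ s2, v1 =1 w1} ->
    {in s1, v1 =1 w1} /\ {in s2, v1 =1 w1}.
  by move=> vw; split=> x xs; apply: vw; rewrite mem_cat xs ?orbT.
have bind x q (v1 w1 : nat -> M) a :
    {in [seq y <- fv q | y != x], v1 =1 w1} ->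
    {in fv q, upd v1 x a =1 upd w1 x a}.
  move=> vw y yq; rewrite /upd; case: ifPn => // yx.
  by apply: vw; rewrite mem_filter yx.
elim: p v w => [s t|s t|t|s t|p IHp|p IHp q IHq|p IHp q IHq|p IHp q IHq|x p IHp
  |x p IHp] v w /=.
- by move=> /sub[/eval_coincidence -> /eval_coincidence ->].
- by move=> /sub[/eval_coincidence -> /eval_coincidence ->].
- by move=> /eval_coincidence ->.
- by move=> /sub[/eval_coincidence -> /eval_coincidence ->].
- by move=> /IHp ->.
- by move=> /sub[/IHp -> /IHq ->].
- by move=> /sub[/IHp -> /IHq ->].
- by move=> /sub[/IHp -> /IHq ->].
- by move=> vw; split=> H a; apply/(IHp _ _ (bind _ _ _ _ a vw))/H.
- by move=> vw; split=> -[a H]; exists a; apply/(IHp _ _ (bind _ _ _ _ a vw))/H.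
Qed.

(** [holds] already ranges over all valuations, so a universal prefix changes nothing; this strips
    the parameters from the comprehension scheme. *)
Lemma holds_alls (M : structure) ys p : holds M (alls ys p) <-> holds M p.
Proof.
elim: ys => //= y ys IH; rewrite -IH; split=> H v.
  by rewrite -(upd_id v y); apply: (H v (v y)).
by move=> a; apply: H.
Qed.

(** * The automaton of a formula *)

(** For [Eq] and [Incl] the bit says that no violation has been read; for [At] the flags say that
    one, respectively two, atoms of the term have been read; for [Lhd], that an atom of the first
    term has been read, and that a strictly later atom of the second followed one. *)
Fixpoint state (p : formula) : finType :=
  match p with
  | Eq _ _ | Incl _ _ => bool
  | At _ | Lhd _ _ => (bool * bool)%type
  | Not q => state q
  | And q r | Or q r | Imp q r => (state q * state r)%type
  | All _ q | Ex _ q => {set state q}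
  end.

Fixpoint init (p : formula) : state p :=
  match p with
  | Eq _ _ | Incl _ _ => true
  | At _ | Lhd _ _ => (false, false)
  | Not q => init q
  | And q r | Or q r | Imp q r => (init q, init r)
  | All _ q | Ex _ q => [set init q]%SET
  end.

Definition tbit (b : nat -> bool) (t : term) : bool :=
  if t is Var x then b x else false.

(* The letter [b] read at an atom tells which variables contain that atom; a
   quantifier is the projection followed by the subset construction. *)
Fixpoint step (p : formula) : state p -> (nat -> bool) -> state p :=
  match p with
  | Eq s t => fun e b => e && (tbit b s == tbit b t)
  | Incl s t => fun e b => e && (tbit b s ==> tbit b t)
  | At t => fun e b => (e.1 || tbit b t, e.2 || e.1 && tbit b t)
  | Lhd s t => fun e b => (e.1 || tbit b s, e.2 || e.1 && tbit b t)
  | Not q => @step q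
  | And q r | Or q r | Imp q r => fun e b => (@step q e.1 b, @step r e.2 b)
  | All x q | Ex x q => fun E b =>
      [set @step q e (upd b x c) | e in E, c in [set: bool]]%SET
  end.

(** The two quantifiers share states and transitions and differ only here. *)
Fixpoint accept (p : formula) : state p -> Prop :=
  match p with
  | Eq s t | Incl s t => fun e => e
  | At t => fun e => e.1 && ~~ e.2
  | Lhd s t => fun e => e.2
  | Not q => fun e => ~ @accept q e
  | And q r => fun e => @accept q e.1 /\ @accept r e.2
  | Or q r => fun e => @accept q e.1 \/ @accept r e.2
  | Imp q r => fun e => @accept q e.1 -> @accept r e.2
  | All x q => fun E => forall e, e \in E -> @accept q e
  | Ex x q => fun E => exists2 e, e \in E & @accept q e
  end.

(* The state reached after reading the atoms of [C], given semantically so that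
   it makes sense also when [C] is infinite. *)
Fixpoint run (M : structure) (C : M -> Prop) (p : formula) (v : nat -> M) :
    state p :=
  match p with
  | Eq s t => `[< forall a, C a -> incl a (eval v s) <-> incl a (eval v t) >]
  | Incl s t => `[< forall a, C a -> incl a (eval v s) -> incl a (eval v t) >]
  | At t =>
      (`[< exists a, C a /\ incl a (eval v t) >],
       `[< exists a b, [/\ C a, C b, a <> b,
                           incl a (eval v t) & incl b (eval v t)] >])
  | Lhd s t =>
      (`[< exists a, C a /\ incl a (eval v s) >],
       `[< exists a b, [/\ C a, C b, lhd a b,
                           incl a (eval v s) & incl b (eval v t)] >])
  | Not q => run C q v
  | And q r | Or q r | Imp q r => (run C q v, run C r v)
  | All x q | Ex x q =>
      [set e | `[< exists A, run C q (upd v x A) = e >]]%SET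
  end.

Definition letter (M : structure) (v : nat -> M) (a : M) : nat -> bool :=
  fun x => `[< incl a (v x) >].

Lemma letter_upd (M : structure) (v : nat -> M) a x A :
  letter (upd v x A) a = upd (letter v a) x `[< incl a A >].
Proof. by apply/funext => y; rewrite /letter /upd; case: eqP. Qed.

(** A run sees the values only through their atoms in [C]; hence changing a witness at a later atom
    leaves the earlier run intact. *)
Lemma run_local (M : structure) (C : M -> Prop) p (v w : nat -> M) :
  (forall x a, C a -> incl a (v x) <-> incl a (w x)) -> run C p v = run C p w.
Proof.
have ev (v1 w1 : nat -> M) : (forall x a, C a -> incl a (v1 x) <-> incl a (w1 x)) ->
    forall t a, C a -> incl a (eval v1 t) <-> incl a (eval w1 t).
  by move=> vw [x|] a Ca //=; apply: vw.
have up (v1 w1 : nat -> M) : (forall x a, C a -> incl a (v1 x) <-> incl a (w1 x)) ->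
    forall y A x a, C a -> incl a (upd v1 y A x) <-> incl a (upd w1 y A x).
  by move=> vw y A x a Ca; rewrite /upd; case: ifP => // _; apply: vw.
elim: p v w => [s t|s t|t|s t|p IHp|p IHp q IHq|p IHp q IHq|p IHp q IHq|x p IHp
  |x p IHp] v w vw /=; have E := ev _ _ vw.
- apply: asbool_equiv_eq; split=> H a Ca; have := H a Ca; have := E s a Ca;
  have := E t a Ca; tauto.
- apply: asbool_equiv_eq; split=> H a Ca; have := H a Ca; have := E s a Ca;
  have := E t a Ca; tauto.
- congr pair; apply: asbool_equiv_eq.
    by split=> -[a [Ca H]]; exists a; split=> //; apply/E.
  by split=> -[a [b [Ca Cb ab Ha Hb]]]; exists a, b; split=> //; apply/E.
- congr pair; apply: asbool_equiv_eq.
    by split=> -[a [Ca H]]; exists a; split=> //; apply/E.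
  by split=> -[a [b [Ca Cb ab Ha Hb]]]; exists a, b; split=> //; apply/E.
- exact: IHp.
- by congr pair; [exact: IHp|exact: IHq].
- by congr pair; [exact: IHp|exact: IHq].
- by congr pair; [exact: IHp|exact: IHq].
- apply/setP => e; rewrite !inE; apply: asbool_equiv_eq.
  by split=> -[A <-]; exists A; apply/IHp/up => // ? ? ?; split=> /vw; apply.
- apply/setP => e; rewrite !inE; apply: asbool_equiv_eq.
  by split=> -[A <-]; exists A; apply/IHp/up => // ? ? ?; split=> /vw; apply.
Qed.

(* The consequences of [T_base] that matter: up to isomorphism, a family of sets
   of atoms closed under definability. *)
Record set_algebra (M : structure) : Prop := SetAlgebra {
  incl_atP : forall A B : M,
    (forall a, at_ a -> incl a A -> incl a B) <-> incl A B;
  incl_anti : forall A B : M, incl A B -> incl B A -> A = B;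
  at_bot : forall a : M, at_ a -> ~ incl a (bot M);
  atP : forall A : M, at_ A <-> (exists a, [/\ at_ a, incl a A &
    forall b, at_ b -> incl b A -> b = a]);
  lhdP : forall A B : M, lhd A B <-> (exists a b, [/\ at_ a, at_ b,
    incl a A, incl b B & lhd a b]);
  comprehension : forall p z (v : nat -> M), exists A : M,
    forall a, at_ a -> (incl a A <-> sat (upd v z a) p);
  lhd_irrefl : forall a : M, at_ a -> ~ lhd a a;
  lhd_trans : forall a b c : M, at_ a -> at_ b -> at_ c ->
    lhd a b -> lhd b c -> lhd a c;
  lhd_total : forall a b : M, at_ a -> at_ b -> [\/ lhd a b, a = b | lhd b a]
}.

Lemma set_algebra_of_model (M : structure) : model M T_base -> set_algebra M.
Proof.
move=> MT.
have refl : forall A : M, incl A A by exact: (MT _ base_refl (fun=> bot M)).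
have anti (A B : M) : incl A B -> incl B A -> A = B.
  by move=> AB BA; apply: (MT _ base_antisym (fun=> bot M) A B); split.
have trans (A B C : M) : incl A B -> incl B C -> incl A C.
  by move=> AB BC; apply: (MT _ base_trans (fun=> bot M) A B C); split.
have bot_le : forall A : M, incl (bot M) A by exact: (MT _ base_bot (fun=> bot M)).
have at_def (A : M) : at_ A <-> A <> bot M /\
    (forall B, incl B A -> B = bot M \/ B = A).
  by have [h1 h2] := MT _ base_at (fun=> bot M) A; split.
have atomic (A : M) : A <> bot M -> exists a, at_ a /\ incl a A.
  exact: (MT _ base_atomic (fun=> bot M) A).
have not_bot (a : M) : at_ a -> ~ incl a (bot M).
  by move=> /at_def[an _] ab; apply: an; apply: anti.
have uniq (a b : M) : at_ a -> at_ b -> incl a b -> a = b.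
  by move=> /at_def[an _] /at_def[_ bb] /bb[].
(* With [B'] a complement of [B], distributivity makes [A] the join of its meets [n] with [B] and
   [m] with [B']. By hypothesis [m] contains no atom, so it is [⊥] by atomicity, and [A] lies below
   [B]. *)
have ext (A B : M) : (forall a, at_ a -> incl a A -> incl a B) -> incl A B.
  move=> H.
  have [B' [[_ [_ Bm]] [T [Ttop TJ]]]] := MT _ base_compl (fun=> bot M) B.
  have [m [mA [mB' mmax]]] := MT _ base_meet (fun=> bot M) A B'.
  have [n [nA [nB nmax]]] := MT _ base_meet (fun=> bot M) A B.
  have m0 : m = bot M.
    apply: contrapT => /atomic[a [aat am]].
    apply: (not_bot a aat); apply: (Bm a); split.
      by apply: H => //; apply: trans mA.
    exact: trans mB'.
  have D := MT _ base_distr (fun=> bot M) A B B' T A n m.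
  have [|_ [_ W]] := D.
    split; first exact: TJ.
    split; last by split; split.
    split; first exact: refl.
    by split; [exact: Ttop|move=> /= W []].
  by apply: (W B); split=> //=; rewrite m0.
split=> //.
- by move=> A B; split=> [/ext//|AB a _ aA]; apply: trans AB.
- move=> A; split=> [Aat|[a [aat aA au]]].
    by exists A; split=> // b bat; apply: uniq.
  suff -> : A = a by [].
  by apply: anti => //; apply: ext => b bat bA; rewrite (au b).
- move=> A B; have [h1 h2] := MT _ base_lhd (fun=> bot M) A B; split.
    move=> /h1[a [aat [b [bat [aA [bB ab]]]]]].
    by exists a, b.
  by move=> [a [b [aat bat aA bB ab]]]; apply: h2; exists a; split=> //; exists b.
(* [N] exceeds [z] and all free variables of [p], so it can name the comprehended set; the other
   free variables become the parameters [Ys]. *)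
- move=> p z v; pose N := (\max_(y <- z :: fv p) y).+1.
  have Nlt y : y \in z :: fv p -> y < N.
    by move=> yp; rewrite ltnS (@leq_bigmax_seq _ _ _ id).
  have Nz : N != z by rewrite gtn_eqF // Nlt // mem_head.
  have Np : N \notin fv p.
    by apply/negP => Np; have := Nlt N; rewrite inE Np orbT ltnn => /(_ isT).
  pose Ys := undup [seq y <- fv p | y != z].
  have uY : seq.uniq [:: z, N & Ys].
    rewrite /= inE eq_sym (negbTE Nz) /= undup_uniq andbT.
    by rewrite !mem_undup !mem_filter eqxx /= negb_and Np orbT.
  have sY : {subset fv p <= z :: Ys}.
    by move=> y yp; rewrite inE mem_undup mem_filter yp andbT orbN.
  have /holds_alls/(_ v)[A HA] := MT _ (base_comprehension uY sY).
  change (sat (upd v N A) (AllAt z (Iff (Incl z N) p))) in HA.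
  exists A => a aat; have [] := (sat_AllAt _ _ _).1 HA a aat.
  rewrite /= updE upd_neq // updE => h1 h2.
  suff E : sat (upd (upd v N A) z a) p <-> sat (upd v z a) p.
    by split=> [/h1/E//|/E/h2].
  apply: sat_coincidence => y yp; rewrite /upd; case: eqP => // _.
  by case: eqP => // yN; rewrite yN (negbTE Np) in yp.
- by move=> a aat; apply: (MT _ base_irrefl (fun=> bot M) a).
- move=> a b c aat bat cat ab bc.
  by apply: (MT _ base_lhd_trans (fun=> bot M) a aat b bat c cat); split.
- move=> a b aat bat.
  have [|[|]] := MT _ base_total (fun=> bot M) a aat b bat.
  + by move=> ?; constructor 1.
  + by move=> ?; constructor 2.
  + by move=> ?; constructor 3.
Qed.

(** * Correctness of the automaton in a set algebra *)

Lemma tbit_letter (M : structure) (v : nat -> M) a t :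
  set_algebra M -> at_ a -> tbit (letter v a) t = `[< incl a (eval v t) >].
Proof. by case: t => //= Msa aat; rewrite asboolF //; exact: at_bot. Qed.

(** Comprehension adds [a] to [A] or removes it. A quantified set can thus be chosen at a new atom
    independently of its earlier atoms. *)
Lemma set_bit (M : structure) (A a : M) (c : bool) : set_algebra M -> at_ a ->
  exists B : M, (incl a B <-> c) /\
    forall b, at_ b -> b <> a -> (incl b B <-> incl b A).
Proof.
move=> Msa aat.
(* Variable 0 ranges over atoms, 1 holds [A] and 2 holds [a]. *)
pose v n := if n is 1 then A else a.
pose p := if c then Or (Incl 0 1) (Eq 0 2) else And (Incl 0 1) (Not (Eq 0 2)).
have [B HB] := comprehension Msa p 0 v; exists B; split.
  rewrite HB // /p; case: c {p HB} => /=; rewrite /upd /v /=.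
    by split=> // _; right.
  by split=> // -[].
by move=> b bat ba; rewrite HB // /p; case: c {p HB} => /=; rewrite /upd /v /=; tauto.
Qed.

(** Lying above all of [C], the atom [s] is new and can only be the right-hand member of a pair
    ordered by [lhd]. A quantified set amounts to its trace on [C] together with a free bit at
    [s]. *)
Lemma run_step (M : structure) (C : M -> Prop) (s : M) p (v : nat -> M) :
  set_algebra M -> (forall a, C a -> at_ a) -> at_ s ->
  (forall a, C a -> lhd a s) ->
  run (fun a => C a \/ a = s) p v = step (run C p v) (letter v s).
Proof.
move=> Msa Cat sat Cs.
have bitE t w : tbit (letter w s) t = `[< incl s (eval w t) >].
  exact: tbit_letter.
have CNs a : C a -> a <> s.
  by move=> /[dup] Ca /Cs + eq_as; rewrite eq_as; exact: lhd_irrefl.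
have sNC a : C a -> ~ lhd s a.
  move=> Ca sa; apply: (lhd_irrefl Msa sat).
  exact: (lhd_trans Msa sat (Cat _ Ca) sat sa (Cs _ Ca)).
have onceE t w : `[< exists a, (C a \/ a = s) /\ incl a (eval w t) >] =
    `[< exists a, C a /\ incl a (eval w t) >] || `[< incl s (eval w t) >].
  rewrite -asbool_or; apply: asbool_equiv_eq; split.
    by move=> [a [[Ca|->] H]]; [left; exists a|right].
  by move=> [[a [Ca H]]|H]; [exists a; split; [left|]|exists s; split; [right|]].
(* Stated for [Ex], this also closes the [All] case by conversion. *)
have quantE i q : (forall w,
      run (fun a => C a \/ a = s) q w = step (run C q w) (letter w s)) ->
    forall w, run (fun a => C a \/ a = s) (Ex i q) w =
      step (run C (Ex i q) w) (letter w s).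
  move=> IH w /=; apply/setP => e; rewrite inE.
  apply/asboolP/imset2P => [[A <-]|[t c]].
    rewrite IH letter_upd; exists (run C q (upd w i A)) `[< incl s A >] => //.
    by rewrite inE; apply/asboolP; exists A.
  rewrite inE => /asboolP[A <-] _ ->.
  (* The bit [c] need not be that of [A]; [B] realises it at [s] and agrees with [A] on [C], so
     [run_local] gives the same earlier state. *)
  have [B [Bs BA]] := set_bit A c Msa sat.
  exists B; rewrite IH letter_upd (asbool_equiv_eq Bs) asboolb.
  congr step; apply: run_local => x a Ca; rewrite /upd; case: ifP => // _.
  by apply: BA; [exact: Cat|exact: CNs].
elim: p v => [t u|t u|t|t u|p IHp|p IHp q IHq|p IHp q IHq|p IHp q IHq|x p IHp
  |x p IHp] v.
- rewrite /= !bitE; apply/asboolP/andP => [H|[/asboolP H /eqP E]].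
    split; first by apply/asboolP => a Ca; apply: H; left.
    by apply/eqP/asbool_equiv_eq/H; right.
  by move=> a [/H//|->]; exact: asbool_eq_equiv.
- rewrite /= !bitE; apply/asboolP/andP => [H|[/asboolP H /implyP E]].
    split; first by apply/asboolP => a Ca; apply: H; left.
    by apply/implyP => /asboolP sv; apply/asboolP; apply: H => //; right.
  by move=> a [|->]; [exact: H|move=> /asboolP/E/asboolP].
- rewrite /= onceE bitE; congr pair.
  rewrite -asbool_and -asbool_or; apply: asbool_equiv_eq; split.
    move=> [a [b [[Ca|->] [Cb|->] ab Ha Hb]]] //.
    + by left; exists a, b.
    + by right; split=> //; exists a.
    + by right; split=> //; exists b.
  move=> [[a [b [Ca Cb ab Ha Hb]]]|[[a [Ca Ha]] Hs]].
    by exists a, b; split=> //; left.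
  by exists a, s; split=> //; [left|right|exact: CNs].
- rewrite /= onceE !bitE; congr pair.
  rewrite -asbool_and -asbool_or; apply: asbool_equiv_eq; split.
    move=> [a [b [[Ca|->] [Cb|->] ab Ha Hb]]].
    + by left; exists a, b.
    + by right; split=> //; exists a.
    + by have := sNC _ Cb ab.
    + by have := lhd_irrefl Msa sat ab.
  move=> [[a [b [Ca Cb ab Ha Hb]]]|[[a [Ca Ha]] Hs]].
    by exists a, b; split=> //; left.
  by exists a, s; split=> //; [left|right|exact: Cs].
- exact: IHp.
- by rewrite /= IHp IHq.
- by rewrite /= IHp IHq.
- by rewrite /= IHp IHq.
- exact: quantE.
- exact: quantE.
Qed.

Lemma run0 (M : structure) (C : M -> Prop) p (v : nat -> M) :
  (forall a, ~ C a) -> run C p v = init p.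
Proof.
move=> C0.
have quantE i q : (forall w, run C q w = init q) ->
    forall w, run C (Ex i q) w = init (Ex i q).
  move=> IH w; apply/setP => e; rewrite !inE; apply/asboolP/eqP.
    by move=> [A <-]; exact: IH.
  (* The carrier is inhabited by [bot M], so the set of reached states is a singleton and not
     empty. *)
  by move=> ->; exists (bot M); exact: IH.
elim: p v => [t u|t u|t|t u|p IHp|p IHp q IHq|p IHp q IHq|p IHp q IHq|x p IHp
  |x p IHp] v.
- by apply/asboolP => a /C0.
- by apply/asboolP => a /C0.
- by congr pair; apply/asboolP; [move=> [a [/C0]]|move=> [a [b [/C0]]]].
- by congr pair; apply/asboolP; [move=> [a [/C0]]|move=> [a [b [/C0]]]].
- exact: IHp.
- by rewrite /= IHp IHq.
- by rewrite /= IHp IHq.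
- by rewrite /= IHp IHq.
- exact: quantE.
- exact: quantE.
Qed.

(** Atomic formulas are decided by their atoms through the set algebra laws; for quantifiers, a
    state lies in the run exactly when some set leads to it. *)
Lemma accept_run (M : structure) p (v : nat -> M) :
  set_algebra M -> accept (run (@at_ M) p v) <-> sat v p.
Proof.
move=> Msa.
elim: p v => [t u|t u|t|t u|p IHp|p IHp q IHq|p IHp q IHq|p IHp q IHq|x p IHp
  |x p IHp] v /=.
- split=> [/asboolP H|->]; last exact/asboolP.
  by apply: (incl_anti Msa); apply/(incl_atP Msa) => a aat; apply H.
- split=> [/asboolP H|H]; first exact/(incl_atP Msa).
  by apply/asboolP/(incl_atP Msa).
- rewrite (atP Msa); split.
    move=> /andP[/asboolP[a [aat aA]] /asboolPn H].
    exists a; split=> // b bat bA; apply: contrapT => ba.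
    by apply: H; exists b, a.
  move=> [a [aat aA au]]; apply/andP; split; first by apply/asboolP; exists a.
  by apply/asboolPn => -[b [c [/au ba /au ca bc /ba eb /ca ec]]]; rewrite eb ec in bc.
- rewrite (lhdP Msa); split=> [/asboolP|H].
    by move=> [a [b [aat bat ab ? ?]]]; exists a, b.
  by apply/asboolP; case: H => [a [b [? ? ? ? ?]]]; exists a, b.
- by rewrite IHp.
- by rewrite IHp IHq.
- by rewrite IHp IHq.
- by rewrite IHp IHq.
- split=> [H a|H e].
    by apply/(IHp (upd v x a))/H; rewrite inE; apply/asboolP; exists a.
  by rewrite inE => /asboolP[a <-]; apply/IHp/H.
- split=> [[e]|[a H]].
    by rewrite inE => /asboolP[a <-] /IHp H; exists a.
  exists (run (@at_ M) p (upd v x a)); last exact/IHp.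
  by rewrite inE; apply/asboolP; exists a.
Qed.

(** * Definability of the run and induction along the order *)

Definition cut (M : structure) (x : M) : M -> Prop :=
  fun a => at_ a /\ (lhd a x \/ a = x).

(** A predicate on valuations, so that parameters and bound variables are treated alike and closure
    properties replace most explicit formulas. *)
Definition definable (M : structure) (P : (nat -> M) -> Prop) : Prop :=
  exists p, forall v, sat v p <-> P v.

Lemma eq_definable (M : structure) (P Q : (nat -> M) -> Prop) :
  definable P -> (forall v, P v <-> Q v) -> definable Q.
Proof. by move=> [p Hp] PQ; exists p => v; rewrite Hp. Qed.

(** Classically [P] is true or false, so a trivial formula or its negation defines it. This admits
    external statements, such as the existence of a standard number of steps, into definable
    predicates. *)
Lemma definable_const (M : structure) (P : Prop) :
  definable (fun _ : nat -> M => P).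
Proof.
have [HP|HP] := pselect P.
  by exists (Eq Bot Bot) => v.
by exists (Not (Eq Bot Bot)) => v; split=> // -[].
Qed.

Lemma definable_and (M : structure) (P Q : (nat -> M) -> Prop) :
  definable P -> definable Q -> definable (fun v => P v /\ Q v).
Proof. by move=> [p Hp] [q Hq]; exists (And p q) => v /=; rewrite Hp Hq. Qed.

Lemma definable_imp (M : structure) (P Q : (nat -> M) -> Prop) :
  definable P -> definable Q -> definable (fun v => P v -> Q v).
Proof. by move=> [p Hp] [q Hq]; exists (Imp p q) => v /=; rewrite Hp Hq. Qed.

Lemma definable_iff (M : structure) (P Q : (nat -> M) -> Prop) :
  definable P -> definable Q -> definable (fun v => P v <-> Q v).
Proof. by move=> dP dQ; apply: definable_and; apply: definable_imp. Qed.

Lemma definable_ex (M : structure) x (P : (nat -> M) -> Prop) :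
  definable P -> definable (fun v => exists A, P (upd v x A)).
Proof.
move=> [p Hp]; exists (Ex x p) => v.
by split=> -[A H]; exists A; apply/Hp.
Qed.

(** A finite conjunction of formulas; this is where finiteness of the state space is used. *)
Lemma definable_forall_fin (M : structure) (T : finType)
    (P : T -> (nat -> M) -> Prop) :
  (forall e, definable (P e)) -> definable (fun v => forall e, P e v).
Proof.
move=> dP.
suff H (s : seq T) : definable (fun v => forall e, e \in s -> P e v).
  apply: (eq_definable (H (enum T))) => v.
  by split=> K e => [|_]; apply: K; rewrite mem_enum.
elim: s => [|e s IHs]; first by apply: (eq_definable (definable_const M True)).
apply: (eq_definable (definable_and (dP e) IHs)) => v; split.
  by move=> [He Hs] e'; rewrite inE => /predU1P[->|/Hs].
by move=> H; split=> [|e' es]; apply: H; rewrite inE ?eqxx ?es ?orbT.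
Qed.

Lemma definable_asbool (M : structure) (P : (nat -> M) -> Prop) (b : bool) :
  definable P -> definable (fun v => `[< P v >] = b).
Proof.
move=> dP; apply: (eq_definable (definable_iff dP (definable_const M b))) => v.
by split=> [/asbool_equiv_eq ->|<-]; [rewrite asboolb|split=> /asboolP].
Qed.

Lemma definable_pair (M : structure) (T U : eqType) (f : (nat -> M) -> T)
    (g : (nat -> M) -> U) (e : T * U) :
  definable (fun v => f v = e.1) -> definable (fun v => g v = e.2) ->
  definable (fun v => (f v, g v) = e).
Proof.
move=> df dg; apply: (eq_definable (definable_and df dg)) => v.
by case: e {df dg} => a b /=; split=> [[-> ->]|[-> ->]].
Qed.

(** Unlike [fv], this includes bound variables, so that a variable above all of them stays fresh
    under every quantifier of [p]. *)
Fixpoint vars (p : formula) : seq nat :=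
  match p with
  | Eq s t | Incl s t | Lhd s t => term_fv s ++ term_fv t
  | At t => term_fv t
  | Not q => vars q
  | And q r | Or q r | Imp q r => vars q ++ vars r
  | All x q | Ex x q => x :: vars q
  end.

Lemma notin_bound z s y : all (fun x => x < z) s -> z <= y -> y \notin s.
Proof.
by move=> /allP sz zy; apply/negP => /sz; rewrite ltnNge zy.
Qed.

(* The variable [z], fresh for [p], stands for the end point of the cut; it is
   reset to [⊥] in the valuation so that the letters read do not depend on it. *)
Lemma definable_run (M : structure) p z (e : state p) :
  all (fun x => x < z) (vars p) ->
  definable (fun v : nat -> M => run (cut (v z)) p (upd v z (bot M)) = e).
Proof.
(* Like [z], the variables [z.+1] and [z.+2] exceed all variables of [p]; they are bound to atoms of
   the cut. *)
have neq1 : z != z.+1 by rewrite ltn_eqF.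
have neq2 : z != z.+2 by rewrite ltn_eqF // ltnS ltnW.
have z1 : z <= z.+1 by [].
have z2 : z <= z.+2 by rewrite ltnW.
have neq12 : z.+1 != z.+2 by rewrite ltn_eqF.
pose inCut (y : nat) := And (At y) (Or (Lhd y z) (Eq y z)).
have evz (v : nat -> M) t y a : all (fun x => x < z) (term_fv t) -> z <= y ->
    eval (upd v y a) t = eval v t.
  by move=> tz zy; rewrite eval_upd //; apply: notin_bound zy.
have once t : all (fun x => x < z) (term_fv t) ->
    definable (fun v : nat -> M => exists a, cut (v z) a /\ incl a (eval v t)).
  move=> tz; exists (Ex z.+1 (And (inCut z.+1) (Incl z.+1 t))) => v.
  rewrite sat_Ex; split=> -[a H]; exists a; move: H.
    by rewrite /= updE upd_neq // evz.
  by rewrite /= updE upd_neq // evz.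
(* [R] will be distinctness for [At] and [lhd] for [Lhd]. *)
have twice t u q (R : M -> M -> Prop) :
    all (fun x => x < z) (term_fv t) -> all (fun x => x < z) (term_fv u) ->
    (forall v : nat -> M, sat v q <-> R (v z.+1) (v z.+2)) ->
    definable (fun v : nat -> M => exists a b, [/\ cut (v z) a, cut (v z) b,
      R a b, incl a (eval v t) & incl b (eval v u)]).
  move=> tz uz Hq.
  exists (Ex z.+1 (Ex z.+2 (And (And (inCut z.+1) (inCut z.+2))
    (And q (And (Incl z.+1 t) (Incl z.+2 u)))))) => v.
  have E a b : sat (upd (upd v z.+1 a) z.+2 b)
      (And (And (inCut z.+1) (inCut z.+2))
        (And q (And (Incl z.+1 t) (Incl z.+2 u)))) <->
      [/\ cut (v z) a, cut (v z) b, R a b, incl a (eval v t) & incl b (eval v u)].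
    rewrite /= Hq !updE !(upd_neq _ _ neq12) !updE !(upd_neq _ _ neq2).
    rewrite !(upd_neq _ _ neq1) !evz //.
    by split=> [[[? ?] [? [? ?]]]|[? ? ? ? ?]]; split.
  by split=> -[a [b /E H]]; exists a, b.
have quant i q : (forall e, all (fun x => x < z) (vars q) ->
      definable (fun v : nat -> M => run (cut (v z)) q (upd v z (bot M)) = e)) ->
    forall e, all (fun x => x < z) (vars (Ex i q)) ->
      definable (fun v : nat -> M =>
        run (cut (v z)) (Ex i q) (upd v z (bot M)) = e).
  move=> IH T /= /andP[iz qz].
  have zi : z != i by rewrite gtn_eqF.
  (* The run equals [T] iff each of the finitely many states [r] is reached exactly when it lies in
     [T]; membership in [T] is a constant. *)
  have dq r : definable (fun v : nat -> M => (exists A,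
      run (cut (v z)) q (upd (upd v z (bot M)) i A) = r) <-> r \in T).
    apply: definable_iff (definable_const M _).
    apply: (eq_definable (definable_ex i (IH r qz))) => v.
    have E A : upd (upd v z (bot M)) i A = upd (upd v i A) z (bot M).
      apply/funext => y; rewrite /upd; case: eqP => // ->.
      by rewrite eq_sym (negbTE zi).
    by split=> -[A <-]; exists A; rewrite E upd_neq.
  apply: (eq_definable (definable_forall_fin dq)) => v; split.
    move=> H; apply/setP => r; rewrite inE.
    by apply/asboolP/idP => /H.
  by move=> <- r; rewrite inE; split=> /asboolP.
elim: p e => [t u|t u|t|t u|p IHp|p IHp q IHq|p IHp q IHq|p IHp q IHq|x p IHp
  |x p IHp] e /=.
- rewrite all_cat => /andP[tz uz]; apply: definable_asbool.
  exists (All z.+1 (Imp (inCut z.+1) (Iff (Incl z.+1 t) (Incl z.+1 u)))) => v.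
  rewrite sat_All; split=> H a; have := H a;
    by rewrite /= updE upd_neq // !evz // !evz.
- rewrite all_cat => /andP[tz uz]; apply: definable_asbool.
  exists (All z.+1 (Imp (inCut z.+1) (Imp (Incl z.+1 t) (Incl z.+1 u)))) => v.
  rewrite sat_All; split=> H a; have := H a;
    by rewrite /= updE upd_neq // !evz // !evz.
- move=> tz; apply: definable_pair; apply: definable_asbool.
    by apply: (eq_definable (once t tz)) => v; rewrite evz.
  apply: (eq_definable (twice t t (Not (Eq z.+1 z.+2)) (fun a b => a <> b) tz tz _)).
    by [].
  by move=> v; rewrite evz.
- rewrite all_cat => /andP[tz uz].
  apply: definable_pair; apply: definable_asbool.
    by apply: (eq_definable (once t tz)) => v; rewrite evz.
  apply: (eq_definable (twice t u (Lhd z.+1 z.+2) (@lhd M) tz uz _)) => //.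
  by move=> v; rewrite !evz.
- exact: IHp.
- by rewrite all_cat => /andP[pz qz]; apply: definable_pair; [exact: IHp|exact: IHq].
- by rewrite all_cat => /andP[pz qz]; apply: definable_pair; [exact: IHp|exact: IHq].
- by rewrite all_cat => /andP[pz qz]; apply: definable_pair; [exact: IHp|exact: IHq].
- exact: quant.
- exact: quant.
Qed.

(** * Induction along the order of atoms *)

Lemma set_algebra_of_fin (M : structure) : model M T_MSOFin -> set_algebra M.
Proof. by move=> MT; apply: set_algebra_of_model => p /fin_base; exact: MT. Qed.

(** Take a least counterexample: comprehension collects the atoms violating [P], which is why [P]
    has to be definable, and the least atom axiom applies. *)
Lemma atom_ind (M : structure) (P : (nat -> M) -> Prop) z (v : nat -> M) :
  model M T_MSOFin -> definable P ->
  (forall x, at_ x -> (forall y, at_ y -> lhd y x -> P (upd v z y)) ->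
    P (upd v z x)) ->
  forall x, at_ x -> P (upd v z x).
Proof.
move=> MT [p Hp] H x xat; apply: contrapT => NPx.
have Msa := set_algebra_of_fin MT.
have [A HA] := comprehension Msa (Not p) z v.
have xA : incl x A by apply/HA => // /Hp.
have [y [yat [yA ymin]]] : exists y, at_ y /\ incl y A /\
    forall u, at_ u -> lhd u y -> ~ incl u A.
  by apply: (MT _ fin_least v A) => /= A0; apply: (at_bot Msa xat); rewrite -A0.
have /HA : incl y A by [].
move=> /(_ yat) /= []; apply/Hp/H => // u uat uy.
apply: contrapT => NPu; apply: (ymin u uat) => //.
by apply/HA => //= /Hp.
Qed.

(** Discreteness gives an immediate predecessor unless [x] is first, so cuts grow one atom at a
    time, as [run_step] requires. *)
Lemma cut_pred (M : structure) (x : M) : model M T_MSOFin -> at_ x ->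
  (forall a, cut x a <-> a = x) \/
  exists y, [/\ at_ y, lhd y x & forall a, cut x a <-> (cut y a \/ a = x)].
Proof.
move=> MT xat.
have Msa := set_algebra_of_fin MT.
have [[y [yat yx]]|Nx] := pselect (exists y, at_ y /\ lhd y x); last first.
  left=> a; split=> [[aat [ax|//]]|->]; last by split; [|right].
  by case: Nx; exists a.
have [w [wat [wx Hw]]] : exists w, at_ w /\ lhd w x /\
    ~ exists a, at_ a /\ lhd w a /\ lhd a x.
  by apply: (MT _ fin_pred (fun=> bot M) x xat); exists y.
right; exists w; split=> // a; split.
  move=> [aat [ax|->]]; last by right.
  left; split=> //; have [|->|wa] := lhd_total Msa aat wat; [by left|by right|].
  by case: Hw; exists a.
move=> [[aat [aw|->]]|->]; split=> //; [left|by left|by right].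
exact: (lhd_trans Msa aat wat xat).
Qed.

(** The right endpoint makes the set of all atoms a cut; the first alternative is the degenerate
    algebra. *)
Lemma cut_last (M : structure) : model M T_MSOFin ->
  (forall a : M, ~ at_ a) \/
  exists2 x : M, at_ x & forall a, at_ a <-> cut x a.
Proof.
move=> MT.
have [ex|Nex] := pselect (exists a : M, at_ a); last first.
  by left=> a aat; apply: Nex; exists a.
have [x [xat Hx]] : exists x : M, at_ x /\
    forall a, at_ a -> x = a \/ lhd a x := MT _ fin_last (fun=> bot M) ex.
right; exists x => // a; split=> [aat|[]//].
by split=> //; have [->|] := Hx a aat; [right|left].
Qed.

(** The constantly false letter is read at every atom when all variables hold [⊥], so these states
    depend on no model. *)
Definition steps (p : formula) (n : nat) : state p :=
  iter n (fun e => step e (fun=> false)) (init p).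

Lemma eq_run (M : structure) (C D : M -> Prop) p (v : nat -> M) :
  (forall a, C a <-> D a) -> run C p v = run D p v.
Proof.
by move=> CD; have -> : C = D by apply/funext => a; apply/propext. Qed.

Lemma run_bot_step (M : structure) (C : M -> Prop) (s : M) p n :
  set_algebra M -> (forall a, C a -> at_ a) -> at_ s ->
  (forall a, C a -> lhd a s) -> run C p (fun=> bot M) = steps p n ->
  run (fun a => C a \/ a = s) p (fun=> bot M) = steps p n.+1.
Proof.
move=> Msa Cat sat Cs E; rewrite run_step // E /=; congr step.
by apply/funext => x; apply/asboolP; exact: at_bot.
Qed.

(** Induction on the end point of the cut, each atom adding one step. The model may have infinitely
    many atoms; [n] only has to lead to the same state, not to count them. *)
Lemma run_reach (M : structure) p : model M T_MSOFin ->
  exists n, run (@at_ M) p (fun=> bot M) = steps p n.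
Proof.
move=> MT.
have Msa := set_algebra_of_fin MT.
have [N0|[x xat xall]] := cut_last MT; first by exists 0; rewrite run0.
rewrite (eq_run _ _ xall).
pose z := (\max_(y <- vars p) y).+1.
have pz : all (fun x => x < z) (vars p).
  by apply/allP => y yp; rewrite ltnS (@leq_bigmax_seq _ _ _ id).
(* For a fixed [e] the existence of [n] does not involve the valuation and is a constant;
   quantifying over the finitely many [e] keeps [P] definable. *)
pose P (v : nat -> M) :=
  forall e, run (cut (v z)) p (upd v z (bot M)) = e -> exists n, e = steps p n.
have dP : definable P.
  apply: definable_forall_fin => e.
  by apply: definable_imp; [exact: definable_run|exact: definable_const].
pose v0 (n : nat) := bot M.
have PE y : P (upd v0 z y) <-> exists n, run (cut y) p v0 = steps p n.
  have E : upd (upd v0 z y) z (bot M) = v0.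
    by apply/funext => i; rewrite /upd; case: eqP.
  by rewrite /P updE E; split=> [|[n Hn] e <-]; [exact|exists n].
apply/PE; apply: (atom_ind MT dP) xat => {xall}x xat IH; apply/PE.
have [xE|[y [yat yx xE]]] := cut_pred MT xat.
  (* The cut of the first atom is the empty set extended by [x]: one step from [init]. *)
  exists 1; rewrite -(@run_bot_step M (fun=> False) x p 0 Msa) //.
    by apply: eq_run => a; rewrite xE; split=> [->|[]//]; right.
  by apply: run0 => a [].
have /PE[n Hn] := IH y yat yx.
exists n.+1; rewrite -(@run_bot_step M (cut y) x p n Msa) //.
- exact: eq_run.
- by move=> a [].
- by move=> a [aat [ay|->//]]; exact: (lhd_trans Msa aat yat xat).
Qed.

(** * The finite structures *)

Lemma holds_sentence (M : structure) p (v : nat -> M) :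
  sentence p -> holds M p <-> sat v p.
Proof.
move=> sp; split=> [|H w]; first exact.
have E : sat v p <-> sat w p by apply: sat_coincidence => x; rewrite sp.
exact/E.
Qed.

(** Acceptance of [steps p n] mentions no model, so two models whose runs end in this state agree on
    [p]. *)
Lemma holds_steps (M : structure) p n : set_algebra M -> sentence p ->
  run (@at_ M) p (fun=> bot M) = steps p n -> holds M p <-> accept (steps p n).
Proof. by move=> Msa sp <-; rewrite (holds_sentence (fun=> bot M) sp) accept_run. Qed.

Lemma incl_set1 n (i : 'I_n) (A : MSOn n) :
  incl ([set i]%classic : MSOn n) A <-> A i.
Proof. by split=> [|Ai j /= ->]; [exact|]. Qed.

Lemma lhd_set1 n (i j : 'I_n) :
  @lhd (MSOn n) [set i]%classic [set j]%classic <-> i < j.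
Proof. by split=> [[_ [_ [-> ->]]]|ij]; [|exists i, j]. Qed.

Lemma neq_bot n (A : MSOn n) : A <> bot (MSOn n) <-> exists i : 'I_n, A i.
Proof.
split=> [|[i Ai] A0]; last by rewrite A0 in Ai.
by move=> /(@eqP (set 'I_n))/set0P.
Qed.

Lemma MSOn_base n : model (MSOn n) T_base.
Proof.
have at1 i : @at_ (MSOn n) [set i]%classic by exists i.
move=> _ [] => [v A|v A B []|v A B C []|v A B|v A B|v|v A B C U V P Q|v A|v A
  |v a /= [i ->]|v a /= [i ->] b /= [j ->] c /= [k ->] []
  |v a /= [i ->] b /= [j ->]|v A|v A|v A B
  |eta x X Ys uY sY].
- exact: (@subset_refl _ A).
- by move=> AB BA; apply/seteqP; split.
- exact: (@subset_trans _ B A C).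
- exists (A `&` B)%classic; split; first exact: subIsetl.
  split; first exact: subIsetr.
  by move=> W [WA WB] i Wi; split; [exact: WA|exact: WB].
- exists (A `|` B)%classic; split; first exact: subsetUl.
  split; first exact: subsetUr.
  by move=> W [AW BW] i [/AW|/BW].
- by exists setT => A; exact: subsetT.
(* Joins and meets are given only by their universal properties, so they are compared with actual
   unions and intersections. *)
- move=> [[BU [CU Umin]] [[VA [VU Vmax]] [[PA [PB Pmax]] [QA [QC Qmax]]]]].
  split; first by apply: (Vmax P); split=> // i /PB/BU.
  split; first by apply: (Vmax Q); split=> // i /QC/CU.
  move=> W [PW QW] i Vi.
  have /(_ i (VU i Vi)) : (U `<=` B `|` C)%classic.
    by apply: (Umin (B `|` C)%classic); split; [exact: subsetUl|exact: subsetUr].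
  case=> [Bi|Ci].
    apply/PW/(Pmax (A `&` B)%classic); last by split; [exact: VA|].
    by split; [exact: subIsetl|exact: subIsetr].
  apply/QW/(Qmax (A `&` C)%classic); last by split; [exact: VA|].
  by split; [exact: subIsetl|exact: subIsetr].
- exists (~` A)%classic; split.
    split; first exact: sub0set.
    split; first exact: sub0set.
    by move=> W [WA WNA] i Wi; apply: (WNA i Wi); exact: WA.
  exists setT; split; first by move=> U; exact: subsetT.
  split; first exact: subsetT.
  split; first exact: subsetT.
  move=> W [AW NAW] i _.
  by have [/AW|/NAW] := pselect (A i).
- move=> /neq_bot[i Ai]; exists [set i]%classic; split; first exact: at1.
  exact/incl_set1.
- by move=> /lhd_set1; rewrite ltnn.
- by move=> /lhd_set1 ij /lhd_set1 jk; apply/lhd_set1; exact: ltn_trans jk.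
- have [ij|ji|ij] := ltngtP i j.
  + by left; exact/lhd_set1.
  + by right; right; exact/lhd_set1.
  + by right; left; congr [set _]%classic; exact: val_inj.
- exact: sub0set.
- split=> /=.
    move=> [i ->]; split; first by apply/neq_bot; exists i.
    by move=> B Bi; exact: (@subset_set1 _ B i Bi).
  move=> [/neq_bot[i Ai] H]; exists i.
  have [] := H [set i]%classic; first exact/incl_set1.
    by move=> /seteqP[/(_ i erefl)].
  by move=> <-.
- split.
    move=> [i [j [Ai Bj ij]]]; exists [set i]%classic; split; first exact: at1.
    exists [set j]%classic; split; first exact: at1.
    by split; [exact/incl_set1|split; [exact/incl_set1|exact/lhd_set1]].
  move=> /= [_ [[i ->] [_ [[j ->] [/incl_set1 Ai [/incl_set1 Bj /lhd_set1 ij]]]]]].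
  by exists i, j.
- apply/holds_alls => v.
  exists [set i | sat (upd v x [set i]%classic : nat -> MSOn n) eta]%classic.
  set A := (X in [eta v with _ |-> X]).
  apply/(sat_AllAt (upd v X A)) => _ [i ->].
  (* [X] is not free in [eta]: [uY] separates it from [x] and [Ys], which by [sY] contain all free
     variables. *)
  have E : sat (upd (upd v X A) x [set i]%classic : nat -> MSOn n) eta <->
      sat (upd v x [set i]%classic : nat -> MSOn n) eta.
    apply: sat_coincidence => y /sY; rewrite /upd inE.
    case: eqP => //= _ yY; case: eqP => // yX; move: uY.
    by rewrite /= -yX yY /= andbF.
  have xX : X != x by move: uY; rewrite /= inE negb_or eq_sym => /andP[/andP[]].
  rewrite /= updE upd_neq // updE.
  by split=> [/incl_set1/E|/E Hi]; last exact/incl_set1.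
Qed.

Lemma MSOn_model n : model (MSOn n) T_MSOFin.
Proof.
have at1 i : @at_ (MSOn n) [set i]%classic by exists i.
move=> _ [p /MSOn_base//|v a /= [i ->]|v a /= [i ->]|v /=|v /=|v A /=].
- move=> [_ [[j ->] /lhd_set1 ij]].
  have i1n : i.+1 < n by exact: leq_ltn_trans ij (ltn_ord j).
  exists [set Ordinal i1n]%classic; split; first exact: at1.
  split; first exact/lhd_set1.
  move=> [_ [[k ->] [/lhd_set1 ik /lhd_set1]]].
  by rewrite ltnS leqNgt ik.
- move=> [_ [[j ->] /lhd_set1 ji]].
  have i1n : i.-1 < n by exact: leq_ltn_trans (leq_pred i) (ltn_ord i).
  have i0 : 0 < i by exact: leq_ltn_trans ji.
  exists [set Ordinal i1n]%classic; split; first exact: at1.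
  split; first by apply/lhd_set1; rewrite /= prednK.
  move=> [_ [[k ->] [/lhd_set1 /= ik /lhd_set1 ki]]].
  by move: ik; rewrite ltnNge -ltnS prednK // ki.
- move=> [_ [i _]].
  have n0 : 0 < n by exact: leq_ltn_trans (ltn_ord i).
  exists [set Ordinal n0]%classic; split; first exact: at1.
  move=> _ [j ->]; have [j0|j0] := posnP j.
    by left; congr [set _]%classic; exact: val_inj.
  by right; exact/lhd_set1.
- move=> [_ [i _]].
  have n0 : 0 < n by exact: leq_ltn_trans (ltn_ord i).
  have n1 : n.-1 < n by rewrite prednK.
  exists [set Ordinal n1]%classic; split; first exact: at1.
  move=> _ [j ->]; have : j <= n.-1 by rewrite -ltnS prednK.
  rewrite leq_eqVlt => /predU1P[jn|jn].
    by left; congr [set _]%classic; exact: val_inj.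
  by right; exact/lhd_set1.
- move=> /neq_bot[i0 Ai0].
  have [i /asboolP Ai imin] :=
    @arg_minnP _ i0 (fun i => `[< A i >]) (fun i => i : nat) (asboolT Ai0).
  exists [set i]%classic; split; first exact: at1.
  split; first exact/incl_set1.
  move=> _ [j ->] /lhd_set1 ji /incl_set1 Aj.
  by have := imin j (asboolT Aj); rewrite leqNgt ji.
Qed.

(** The points are added in increasing order inside the fixed structure, so the induction is on the
    length [k] of an initial segment and not on [n]. *)
Lemma run_MSOn n p : run (@at_ (MSOn n)) p (fun=> bot (MSOn n)) = steps p n.
Proof.
pose below k (A : MSOn n) := exists2 i : 'I_n, i < k & A = [set i]%classic.
have -> : run (@at_ (MSOn n)) p (fun=> bot (MSOn n)) =
    run (below n) p (fun=> bot (MSOn n)).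
  apply: eq_run => A; split=> [[i ->]|[i _ ->]]; last by exists i.
  by exists i; first exact: ltn_ord.
suff: forall k, k <= n -> run (below k) p (fun=> bot (MSOn n)) = steps p k by exact.
elim=> [_|k IH kn]; first by apply: run0 => A [].
have Msa := set_algebra_of_fin (@MSOn_model n).
rewrite -(@run_bot_step (MSOn n) (below k) [set Ordinal kn]%classic p k Msa).
- apply: eq_run => A; split.
    move=> [i]; rewrite ltnS leq_eqVlt => /predU1P[ik ->|ik ->].
      by right; congr [set _]%classic; exact: val_inj.
    by left; exists i.
  by move=> [[i ik ->]|->]; [exists i; first exact: ltnW|exists (Ordinal kn)].
- by move=> _ [i _ ->]; exists i.
- by exists (Ordinal kn).
- by move=> _ [i ik ->]; exact/lhd_set1.
- exact: IH (ltnW kn).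
Qed.

Theorem theorem3p11 (phi : formula) (hphi : sentence phi) :
  entails T_MSOFin phi <-> (forall n : nat, holds (MSOn n) phi).
Proof.
split=> [H n|H M MT]; first exact/H/MSOn_model.
(* This [n] depends on [phi] as well as on [M]; the runs of [M] and of [MSOn n] end in the same
   state. *)
have [n Hn] := run_reach phi MT.
have Msa := set_algebra_of_fin MT.
apply/(holds_steps Msa hphi Hn).
by apply/(holds_steps (set_algebra_of_fin (@MSOn_model n)) hphi (run_MSOn n phi)).
Qed.
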